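(* Let $n\ge 1$, let $\lambda \vdash n$ be a partition whose conjugate is $\lambda' = (s,r)$ with $s\ge r\ge 1$ (so the Young diagram of $\lambda$ has exactly two columns, of lengths $s$ and $r$), and let $\Delta$ be an integer with $0\le \Delta < r$. Then \[ w^{\Delta}_\lambda = p_{2} (\Delta) \times \begin{cases} 1, & \text{if } s = r, \\ 2, & \text{if } s > r. \end{cases} \]
   Context: For a permutation $\pi=(\pi_1,\dots,\pi_n)\in S_n$ (one-line notation), its inversion number is $\mathrm{inv}(\pi)=\#\{i<j:\pi_i>\pi_j\}$. The shape $\mathrm{sh}(\pi)$ of $\pi$ is the common shape of the insertion and recording tableaux associated to $\pi$ by the Robinson–Schensted correspondence (Schensted row insertion of $\pi_1,\dots,\pi_n$). For a partition $\lambda\vdash n$, $\lambda'$ denotes its conjugate, $W_\lambda$ is the set of permutations of shape $\lambda$, and for $\Delta\ge 0$, $W_\lambda^\Delta$ is the set of $\pi\in W_\lambda$ whose inversion number exceeds the minimum of $\mathrm{inv}$ over $W_\lambda$ by exactly $\Delta$; $w_\lambda^\Delta=\#W_\lambda^\Delta$. For $c\ge 1$, $p_c(m)$ denotes the number of partitions of $m$ into parts of $c$ colours, i.e. $\sum_{m\ge0}p_c(m)x^m=\prod_{k\ge1}(1-x^k)^{-c}$. *)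

(* Defs.v *)
From mathcomp Require Import all_boot all_order all_fingroup.

Set Implicit Arguments.
Unset Strict Implicit.
Unset Printing Implicit Defensive.

Definition is_partition_of (n : nat) (la : seq nat) : bool :=
  [&& sorted geq la, 0 \notin la & sumn la == n].

(** The [j]-th part of the conjugate (counting from 0) is the length of the
    [j]-th column of the diagram of [la], i.e. the number of parts [> j]. *)
Definition conj_part (la : seq nat) : seq nat :=
  [seq count (fun x => j < x) la | j <- iota 0 (head 0 la)].

(** Permutations act on [{0, ..., n-1}], so the letters of the one-line word
    are shifted by one from the usual [1, ..., n]. *)
Definition one_line n (pi : 'S_n) : seq nat := [seq val (pi i) | i <- enum 'I_n].

Definition inv n (pi : 'S_n) : nat :=
  #|[set p : 'I_n * 'I_n | (p.1 < p.2) && (pi p.2 < pi p.1)]|.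

(** Schensted row insertion of [x] into the tableau [T], given by its list of
    rows from top to bottom: [x] replaces the first larger entry of the row,
    which is inserted into the next row, or else is appended to the row. *)
Fixpoint row_insert (x : nat) (T : seq (seq nat)) : seq (seq nat) :=
  if T is row :: T' then
    let i := find (fun y => x < y) row in
    if i < size row then set_nth 0 row i x :: row_insert (nth 0 row i) T'
    else rcons row x :: T'
  else [:: [:: x]].

Definition insertion_tableau (w : seq nat) : seq (seq nat) :=
  foldl (fun T x => row_insert x T) [::] w.

(** The recording tableau has the shape of the insertion tableau by
    construction, so only the latter is defined. *)
Definition sh n (pi : 'S_n) : seq nat :=
  [seq size row | row <- insertion_tableau (one_line pi)].

Definition W n (la : seq nat) : {set 'S_n} := [set pi | sh pi == la].

(** [sigma] is a witness that the minimum of [inv] over [W n la] is attained. *)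
Definition W_excess n (la : seq nat) (Delta : nat) : {set 'S_n} :=
  [set pi in W n la |
    [exists sigma in W n la,
       [forall tau in W n la, inv sigma <= inv tau] &&
       (inv pi == inv sigma + Delta)]].

Definition w n (la : seq nat) (Delta : nat) : nat := #|W_excess n la Delta|.

(** Number of partitions of [m] into parts of [c] colours, i.e. the coefficient
    of [x ^ m] in the product over [k >= 1] of [(1 - x ^ k) ^ (-c)].  Such a
    partition is encoded by its multiplicities: [f (k, a)] is the number of parts
    equal to [k + 1] of colour [a]; parts and multiplicities are at most [m]. *)
Definition p (c m : nat) : nat :=
  #|[set f : {ffun 'I_m * 'I_c -> 'I_m.+1} |
      \sum_(ka : 'I_m * 'I_c) ka.1.+1 * f ka == m]|.

(* Main.v *)
(** The argument counts non-inversions: a permutation of shape [la] has no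
    increasing subsequence of length 3 and its longest decreasing subsequence has
    length [s] (Schensted), and minimal [inv] means [s * r] non-inversions.
    Let [L] be the set of positions that are followed by a larger value.  Both [L]
    and its complement carry decreasing subsequences, so a non-inversion pairs an
    element of [L] with an element outside; the missing pairs are those out of
    order in position and those out of order in value.  If only [Delta < r] pairs
    are missing from [s * r], a decreasing set of size [s] forces [#|L|] to be [r]
    or [s].  Then the two kinds of missing pairs form Young diagrams in opposite
    corners of an [r] by [s] rectangle, too small to meet or to touch the far
    sides, so they are two arbitrary partitions of total size [Delta]. *)

Require Import Defs.
From mathcomp Require Import all_boot all_order all_fingroup.
From mathcomp Require Import all_algebra zify ring.

Set Implicit Arguments.
Unset Strict Implicit.
Unset Printing Implicit Defensive.

Import GRing.Theory.

(** * Schensted's theorem on longest monotone subsequences *)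

Lemma subseq_catP (T : eqType) (t s1 s2 : seq T) :
  reflect (exists t1 t2, [/\ t = t1 ++ t2, subseq t1 s1 & subseq t2 s2])
          (subseq t (s1 ++ s2)).
Proof.
apply: (iffP idP) => [/subseqP [m sz_m ->]|[t1 [t2 [-> sub1 sub2]]]]; last exact: cat_subseq.
exists (mask (take (size s1) m) s1), (mask (drop (size s1) m) s2).
split; try exact: mask_subseq.
by rewrite -mask_cat ?cat_take_drop // size_takel // sz_m size_cat leq_addr.
Qed.

Definition has_dec (w : seq nat) (k : nat) : Prop :=
  exists t, [/\ subseq t w, pairwise gtn t & size t = k].

Lemma size_dec_sorted (t s : seq nat) :
  subseq t s -> sorted leq s -> pairwise gtn t -> size t <= 1.
Proof.
move=> sub_ts /(subseq_sorted leq_trans sub_ts).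
by case: t {sub_ts} => [|a [|b t]] //= /andP [le_ab _] /andP [/andP [? _] _]; lia.
Qed.

(* The bounds on the values are kept so that [t'] can replace [t] inside a longer
   decreasing sequence. *)
Definition dec_embeds (w1 w2 : seq nat) : Prop :=
  forall t, subseq t w1 -> pairwise gtn t ->
  exists t', [/\ subseq t' w2, pairwise gtn t', size t' = size t,
    forall z, all (gtn z) t -> all (gtn z) t' & forall z, all (ltn z) t -> all (ltn z) t'].

(** By the two bound clauses, the replaced middle block still lies below the letters chosen in [u]
    and above those chosen in [v]. *)
Lemma dec_embeds_cat (w1 w2 u v : seq nat) (k : nat) :
  dec_embeds w1 w2 -> has_dec (u ++ w1 ++ v) k -> has_dec (u ++ w2 ++ v) k.
Proof.
move=> emb [t [/subseq_catP [t0 [t' [-> sub0 /subseq_catP [t1 [t2 [-> sub1 sub2]]]]]]]].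
rewrite !pairwise_cat allrel_catr.
move=> /and3P [/andP [t01 t02] pw0 /and3P [t12 pw1 pw2]] sz.
have [t1' [sub1' pw1' sz1 up low]] := emb _ sub1 pw1.
exists (t0 ++ t1' ++ t2); split.
- by rewrite !cat_subseq.
- rewrite !pairwise_cat allrel_catr pw0 pw1' pw2 t02 !andbT /=; apply/andP; split.
    by apply/allP => z z_t0; apply: up; exact: (allP t01).
  apply/allrelP => a b a_t1 b_t2.
  have /low/allP/(_ a a_t1) // : all (ltn b) t1.
  by apply/allP => c c_t1; exact: (allrelP t12).
- by rewrite -sz !size_cat sz1.
Qed.

(** * One bump: [x] replaces [y] in the row [R1 ++ y :: R2] *)

Section BumpedRow.

Variables (R1 R2 : seq nat) (x y : nat).
Hypotheses (sortedR : sorted leq (R1 ++ y :: R2)) (le_R1_x : all (leq^~ x) R1)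
  (lt_xy : x < y).

Let le_y_R2 z : z \in R2 -> y <= z.
Proof.
move: sortedR; rewrite (sorted_pairwise leq_trans) pairwise_cat /=.
by case/and3P=> _ _ /andP [/allP le_y _] /le_y.
Qed.

Let sortedR' : sorted leq (R1 ++ x :: R2).
Proof.
move: sortedR; rewrite !(sorted_pairwise leq_trans) !pairwise_cat !allrel_consr /=.
case/and3P=> /andP [_ ->] -> /andP [le_y ->]; rewrite !andbT le_R1_x /=.
by apply: sub_all le_y => z; apply/leq_trans/ltnW.
Qed.

(** Only a pair [z], [x] with [z] in the row and [x < z] needs replacing. Such a [z] is at least
    [y], so the pair [y], [x] serves, and [x < y <= z] preserves the bounds. *)
Lemma dec_embeds_bump :
  dec_embeds ((R1 ++ y :: R2) ++ [:: x]) (y :: R1 ++ x :: R2).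
Proof.
have mem1 z : z \in (R1 ++ y :: R2) ++ [:: x] -> subseq [:: z] (y :: R1 ++ x :: R2).
  by rewrite sub1seq !(inE, mem_cat); case/orP=> [/or3P [] ->|->]; rewrite ?orbT.
have subyx : subseq [:: y; x] (y :: R1 ++ x :: R2).
  by rewrite /= eqxx sub1seq mem_cat inE eqxx orbT.
move=> t /[dup] sub_t /subseq_catP [ta [tb [-> sub_a sub_b]]] pw.
have sz_a : size ta <= 1.
  by apply: (size_dec_sorted sub_a sortedR); move: pw; rewrite pairwise_cat; case/and3P.
have {sub_b} tbP : tb = [::] \/ tb = [:: x].
  by case: tb sub_b {pw} => [|c [|d tb]] /=; [left|case: ifP => // /eqP->; right|case: ifP].
case: ta sz_a sub_a pw => [|z [|//]] _ sub_a pw; case: tbP pw => -> /= pw.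
- by exists [::]; split=> //; rewrite sub0seq.
- by exists [:: x]; split=> //; apply: mem1; rewrite mem_cat inE eqxx orbT.
- exists [:: z]; split=> //; apply: mem1.
  by rewrite mem_cat -sub1seq sub_a.
have le_yz : y <= z.
  move: sub_a pw; rewrite sub1seq mem_cat inE => /or3P [/(allP le_R1_x) /= ?|/eqP->|/le_y_R2] //.
  by rewrite !andbT; lia.
exists [:: y; x]; split=> //=; first by rewrite lt_xy.
  by move=> k /and3P [? ? _]; rewrite andbT; lia.
by move=> k /and3P [? ? _]; rewrite andbT; lia.
Qed.

(** Symmetrically, an entry [z < y] of the new row is at most [x], so a pair [y], [z] can be
    exchanged for [y], [x]. *)
Lemma dec_embeds_unbump :
  dec_embeds (y :: R1 ++ x :: R2) ((R1 ++ y :: R2) ++ [:: x]).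
Proof.
have mem1 z : z \in y :: R1 ++ x :: R2 -> subseq [:: z] ((R1 ++ y :: R2) ++ [:: x]).
  rewrite sub1seq !(inE, mem_cat).
  by case/or4P => ->; rewrite ?orbT.
have subyx : subseq [:: y; x] ((R1 ++ y :: R2) ++ [:: x]).
  rewrite (_ : [:: y; x] = [:: y] ++ [:: x]) // cat_subseq //.
  by rewrite sub1seq mem_cat inE eqxx orbT.
rewrite -cat1s => t /[dup] sub_t /subseq_catP [ta [tb [-> sub_a sub_b]]] pw.
have sz_b : size tb <= 1.
  by apply: (size_dec_sorted sub_b sortedR'); move: pw; rewrite pairwise_cat; case/and3P.
have {sub_a} taP : ta = [::] \/ ta = [:: y].
  by case: ta sub_a {pw sub_t} => [|c [|d ta]] /=; [left|case: ifP => // /eqP->; right|case: ifP].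
case: tb sz_b sub_b pw sub_t => [|z [|//]] _ sub_b pw sub_t; case: taP pw sub_t => -> /= pw sub_t.
- by exists [::]; split=> //; rewrite sub0seq.
- by exists [:: y]; split=> //; apply: mem1; rewrite inE eqxx.
- by exists [:: z]; split=> //; apply: mem1; rewrite inE -sub1seq sub_b orbT.
have le_zx : z <= x.
  move: sub_b pw; rewrite sub1seq mem_cat inE => /or3P [/(allP le_R1_x)|/eqP->|/le_y_R2] //=.
  by rewrite !andbT; lia.
exists [:: y; x]; split=> //=; first by rewrite lt_xy.
  by move=> k /and3P [? ? _]; rewrite andbT; lia.
by move=> k /and3P [? ? _]; rewrite andbT; lia.
Qed.

End BumpedRow.

Lemma has_dec_bump (R : seq nat) (x k : nat) (u v : seq nat) :
  let i := find (fun y => x < y) R in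
  sorted leq R -> i < size R ->
  has_dec (u ++ R ++ x :: v) k <->
  has_dec (u ++ nth 0 R i :: set_nth 0 R i x ++ v) k.
Proof.
move=> i sortedR lt_i.
set y := nth 0 R i; set R1 := take i R; set R2 := drop i.+1 R.
have defR : R = R1 ++ y :: R2 by rewrite -drop_nth // cat_take_drop.
have defR' : set_nth 0 R i x = R1 ++ x :: R2 by rewrite set_nthE lt_i.
have lt_xy : x < y by apply: (nth_find 0 (a := fun y => x < y)); rewrite has_find.
have le_R1 : all (leq^~ x) R1.
  apply/(all_nthP 0) => j; rewrite size_takel ?(ltnW lt_i) // => lt_ji.
  by rewrite nth_take // leqNgt; apply/negbT/(before_find 0 (a := fun y => x < y)).
have sR : sorted leq (R1 ++ y :: R2) by rewrite -defR.
rewrite defR' defR -cat1s (catA _ [:: x]) -cat_cons.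
by split; apply: dec_embeds_cat; [apply: dec_embeds_bump|apply: dec_embeds_unbump].
Qed.

(** Rows are read from the bottom up, so an entry bumped to the front of its row stands right after
    the next row, where it is inserted in turn. *)
Definition reading (T : seq (seq nat)) : seq nat := flatten (rev T).

Lemma reading_cons (R : seq nat) (T : seq (seq nat)) : reading (R :: T) = reading T ++ R.
Proof. by rewrite /reading rev_cons flatten_rcons. Qed.

(** The letter [x] passes down the rows one bump at a time; [v] is arbitrary so that it can absorb
    the rows already passed. *)
Lemma has_dec_row_insert (T : seq (seq nat)) (x k : nat) (v : seq nat) :
  all (sorted leq) T ->
  has_dec (reading (row_insert x T) ++ v) k <-> has_dec (reading T ++ x :: v) k.
Proof.
elim: T x v => [|R T IH] x v //= /andP [sortedR sortedT].
case: ifP => [lt_i|_]; rewrite !reading_cons -!catA; last by rewrite cat_rcons.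
by rewrite IH // has_dec_bump.
Qed.

(** The column condition of a semistandard tableau for two consecutive rows. *)
Definition dominates (R R' : seq nat) : bool :=
  (size R' <= size R) && all (fun i => nth 0 R i < nth 0 R' i) (iota 0 (size R')).

Lemma dominatesP (R R' : seq nat) :
  reflect (size R' <= size R /\ forall i, i < size R' -> nth 0 R i < nth 0 R' i)
          (dominates R R').
Proof.
apply: (iffP andP) => [[le_sz /allP dom]|[le_sz dom]]; split=> //.
  by move=> i lt_i; apply: dom; rewrite mem_iota.
by apply/allP => i; rewrite mem_iota => /dom.
Qed.

Definition tableau (T : seq (seq nat)) : bool :=
  [&& all (sorted leq) T, [::] \notin T & sorted dominates T].

Lemma tableau_cons (R : seq nat) (T : seq (seq nat)) :
  tableau (R :: T) =
  [&& sorted leq R, R != [::], (if T is R' :: _ then dominates R R' else true) & tableau T].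
Proof.
rewrite /tableau /= inE negb_or [[::] == R]eq_sym.
by case: T => [|R' T] /=; case: (sorted leq R); case: (R != _); rewrite /= ?andbT ?andbF //;
  case: (dominates _ _); rewrite /= ?andbF.
Qed.

(** If no entry exceeds [x], [find] returns the size of the row and [set_nth] appends [x], so both
    cases of row insertion are covered. *)
Definition insert_in_row (x : nat) (R : seq nat) : seq nat :=
  set_nth 0 R (find (fun y => x < y) R) x.

Lemma row_insert_cons (x : nat) (R : seq nat) (T : seq (seq nat)) :
  row_insert x (R :: T) = insert_in_row x R ::
    (let i := find (fun y => x < y) R in
     if i < size R then row_insert (nth 0 R i) T else T).
Proof.
rewrite /= /insert_in_row; case: ifP => // /negbT; rewrite -leqNgt => ge_i.
have -> : find (fun y => x < y) R = size R by apply/eqP; rewrite eqn_leq find_size.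
by rewrite set_nthE ltnn subnn /= cats1.
Qed.

Lemma size_insert_in_row (x : nat) (R : seq nat) :
  size (insert_in_row x R) = maxn (find (fun y => x < y) R).+1 (size R).
Proof. by rewrite size_set_nth. Qed.

Lemma nth_insert_in_row (x : nat) (R : seq nat) (j : nat) :
  nth 0 (insert_in_row x R) j = if j == find (fun y => x < y) R then x else nth 0 R j.
Proof. by rewrite nth_set_nth. Qed.

Lemma nth_lt_find (x : nat) (R : seq nat) (j : nat) :
  j < find (fun y => x < y) R -> nth 0 R j <= x.
Proof. by move=> lt_j; rewrite leqNgt; apply/negbT/(before_find 0 (a := fun y => x < y)). Qed.

Lemma nth_find_lt (x : nat) (R : seq nat) :
  let i := find (fun y => x < y) R in i < size R -> x < nth 0 R i.
Proof. by move=> i lt_i; apply: (nth_find 0 (a := fun y => x < y)); rewrite has_find. Qed.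

Lemma sorted_insert_in_row (x : nat) (R : seq nat) :
  sorted leq R -> sorted leq (insert_in_row x R).
Proof.
move=> sortedR; have mono := sorted_leq_nth leq_trans leqnn 0 sortedR.
have szi := find_size (fun y => x < y) R.
apply/(sortedP 0) => j; rewrite size_insert_in_row !nth_insert_in_row => lt_j.
case: eqP => [eq_j|ne_j]; case: eqP => [eq_j'|ne_j'] //.
- have lt_i : find (fun y => x < y) R < size R by lia.
  apply: leq_trans (ltnW (nth_find_lt lt_i)) _; apply: mono; rewrite ?inE; lia.
- by apply: nth_lt_find; lia.
- apply: mono; rewrite ?inE; lia.
Qed.

(** The bumped entry moves weakly left. If it stays in column [i], the entry above it is now [x];
    further left, the entry above is at most [x]. Elsewhere the entries of [R] do not grow. *)
Lemma dominates_insert (x : nat) (R R' : seq nat) :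
  let i := find (fun y => x < y) R in
  sorted leq R -> dominates R R' ->
  dominates (insert_in_row x R) (if i < size R then insert_in_row (nth 0 R i) R' else R').
Proof.
move=> i sortedR /dominatesP [le_sz dom].
have mono := sorted_leq_nth leq_trans leqnn 0 sortedR.
have le_ins j : j < size R -> nth 0 (insert_in_row x R) j <= nth 0 R j.
  by rewrite nth_insert_in_row; case: eqP => // -> lt_j; apply/ltnW/nth_find_lt.
apply/dominatesP; case: ifP => [lt_i|_]; last first.
  split=> [|j lt_j]; first by rewrite size_insert_in_row; lia.
  by apply: leq_ltn_trans (dom j lt_j); apply: le_ins; lia.
set y := nth 0 R i; set i' := find (fun z => y < z) R'.
have szi' : i' <= size R' := find_size _ _.
(* The entry of [R'] below [y], if there is one, exceeds [y]. *)
have le_i' : i' <= i.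
  rewrite leqNgt; apply/negP => lt_i'.
  have := nth_lt_find lt_i'; rewrite leqNgt dom //; lia.
split=> [|j]; rewrite !size_insert_in_row -/i -/i'; first lia.
move=> lt_j; rewrite (nth_insert_in_row y) -/i'; case: eqP => [->|ne_j]; last first.
  by apply: leq_ltn_trans (dom j _); [apply: le_ins; lia|lia].
rewrite nth_insert_in_row -/i; case: eqP => [_|ne_i]; first exact: nth_find_lt.
have lt_ii : i' < i by lia.
apply: leq_ltn_trans (nth_lt_find lt_ii) _; exact: nth_find_lt.
Qed.

Lemma tableau_row_insert (x : nat) (T : seq (seq nat)) :
  tableau T -> tableau (row_insert x T).
Proof.
elim: T x => [|R T IH] x //; rewrite row_insert_cons !tableau_cons.
move=> /and4P [sortedR nil_R domR tabT]; rewrite sorted_insert_in_row //=.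
rewrite -size_eq0 size_insert_in_row -lt0n leq_max /=; apply/andP; split; last first.
  by case: ifP => _; [apply: IH|].
case: T domR {IH tabT} => [_|R' T domR].
  case: ifP => //= lt_i.
  apply/dominatesP; rewrite size_insert_in_row /=; split=> [|[|j] //= _]; first lia.
  rewrite nth_insert_in_row; case: eqP => [_|/eqP]; first exact: nth_find_lt.
  rewrite eq_sym -lt0n => gt_i.
  exact: leq_ltn_trans (nth_lt_find gt_i) (nth_find_lt lt_i).
have := dominates_insert x sortedR domR.
by case: ifP => // _; rewrite row_insert_cons.
Qed.

Lemma insertion_tableau_rcons (v : seq nat) (x : nat) :
  insertion_tableau (rcons v x) = row_insert x (insertion_tableau v).
Proof. by rewrite /insertion_tableau foldl_rcons. Qed.

Lemma tableau_insertion (v : seq nat) : tableau (insertion_tableau v).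
Proof.
by elim/last_ind: v => // v x IH; rewrite insertion_tableau_rcons tableau_row_insert.
Qed.

Lemma has_dec_insertion (v : seq nat) (k : nat) :
  has_dec (reading (insertion_tableau v)) k <-> has_dec v k.
Proof.
(* The suffix [u] stands for the letters still to be inserted. *)
suff eqv u : has_dec (reading (insertion_tableau v) ++ u) k <-> has_dec (v ++ u) k.
  by have := eqv [::]; rewrite !cats0.
elim/last_ind: v u => [|v x IH] u //.
rewrite insertion_tableau_rcons has_dec_row_insert ?IH ?cat_rcons //.
by case/and3P: (tableau_insertion v).
Qed.

(** Each weakly increasing row contributes at most one letter. *)
Lemma has_dec_reading_le (T : seq (seq nat)) (k : nat) :
  all (sorted leq) T -> has_dec (reading T) k -> k <= size T.
Proof.
elim: T k => [|R T IH] k /=; first by move=> _ [t [/eqP-> _ <-]].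
move=> /andP [sortedR sortedT]; rewrite reading_cons.
move=> [t [/subseq_catP [t1 [t2 [-> sub1 sub2]]]]]; rewrite pairwise_cat.
move=> /and3P [_ pw1 pw2] <-; rewrite size_cat -addn1 leq_add ?(size_dec_sorted sub2) //.
by apply: IH => //; exists t1.
Qed.

(** The first column, read upwards, is strictly decreasing. *)
Lemma has_dec_reading_size (T : seq (seq nat)) :
  tableau T -> has_dec (reading T) (size T).
Proof.
(* The lower bound on [t] allows the corner of a row placed on top to be appended. *)
move=> tabT; suff [t []]: exists t, [/\ subseq t (reading T), pairwise gtn t, size t = size T
    & all (leq (nth 0 (head [::] T) 0)) t] by exists t.
elim: T tabT => [|R T IH]; first by exists [::].
rewrite tableau_cons => /and4P [_ nil_R domR tabT].
have [t [sub_t pw_t sz_t le_t]] := IH tabT.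
case: R nil_R domR => [|a R] // _ domR.
have lt_t : all (ltn a) t.
  case: T sz_t le_t domR tabT {IH sub_t} => [/size0nil -> //|R' T _ le_t /dominatesP [_ dom]].
  rewrite tableau_cons => /and4P [_ nil_R' _ _].
  by apply: sub_all le_t => z; apply: leq_trans; apply: (dom 0); rewrite lt0n size_eq0.
exists (rcons t a); rewrite reading_cons; split.
- by rewrite -cats1 cat_subseq // sub1seq inE eqxx.
- by rewrite -cats1 pairwise_cat pw_t /= andbT allrel1r.
- by rewrite size_rcons sz_t.
- by rewrite all_rcons leqnn /=; apply: sub_all lt_t => z; apply: ltnW.
Qed.

Lemma size_insertion_tableau (v : seq nat) (k : nat) :
  has_dec v k -> k <= size (insertion_tableau v).
Proof.
move=> /has_dec_insertion; apply: has_dec_reading_le.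
by case/and3P: (tableau_insertion v).
Qed.

Lemma has_dec_size_insertion (v : seq nat) : has_dec v (size (insertion_tableau v)).
Proof. exact/has_dec_insertion/has_dec_reading_size/tableau_insertion. Qed.

(** * Weakly increasing subsequences and the first row *)

Lemma subseq_rconsP (T : eqType) (t v : seq T) (z x : T) :
  subseq (rcons t z) (rcons v x) ->
  subseq (rcons t z) v \/ z = x /\ subseq t v.
Proof.
rewrite -(cats1 v) => /subseq_catP [t1 [t2 [eq_t sub1 sub2]]].
case: t2 sub2 eq_t => [_|b t2]; first by rewrite cats0 => ->; left.
rewrite /=; case: (b =P x) => // -> /eqP -> {t2}; rewrite cats1 => /rcons_inj [-> ->].
by right.
Qed.

Definition first_row (v : seq nat) : seq nat := head [::] (insertion_tableau v).

Lemma first_row_rcons (v : seq nat) (x : nat) :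
  first_row (rcons v x) = insert_in_row x (first_row v).
Proof.
rewrite /first_row insertion_tableau_rcons.
by case: (insertion_tableau v) => // R T; rewrite row_insert_cons.
Qed.

Lemma sorted_leq_rcons2 (t : seq nat) (y x : nat) :
  sorted leq (rcons (rcons t y) x) = sorted leq (rcons t y) && (y <= x).
Proof. by case: t => [|a t] /=; rewrite ?andbT // !rcons_path last_rcons. Qed.

(** When [x] enters column [i > 0], its left neighbour is at most [x] and already ends a weakly
    increasing subsequence of length [i]. *)
Lemma inc_first_row (v : seq nat) (i : nat) : i < size (first_row v) ->
  exists t, [/\ subseq (rcons t (nth 0 (first_row v) i)) v,
                sorted leq (rcons t (nth 0 (first_row v) i)) & size t = i].
Proof.
elim/last_ind: v i => [|v x IH] i //.
rewrite first_row_rcons size_insert_in_row nth_insert_in_row => lt_i.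
have szi := find_size (fun y => x < y) (first_row v).
case: eqP => [eq_i|ne_i]; last first.
  have [|t [sub_t sorted_t sz_t]] := IH i; first lia.
  by exists t; split=> //; apply: subseq_trans sub_t (subseq_rcons _ _).
case: i eq_i {lt_i} => [|i] eq_i.
  by exists [::]; split=> //; rewrite sub1seq mem_rcons inE eqxx.
have [|t [sub_t sorted_t sz_t]] := IH i; first lia.
exists (rcons t (nth 0 (first_row v) i)); split; last by rewrite size_rcons sz_t.
  by rewrite -!(cats1 _ x) cat_subseq.
by rewrite sorted_leq_rcons2 sorted_t nth_lt_find // -eq_i.
Qed.

(** The entry in a given column never grows during insertion, and a letter extending [t] cannot land
    to the left of column [size t], since the entries before that column are at most the last letter
    of [t]. *)
Lemma first_row_inc (v t : seq nat) (z : nat) :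
  subseq (rcons t z) v -> sorted leq (rcons t z) ->
  size t < size (first_row v) /\ nth 0 (first_row v) (size t) <= z.
Proof.
elim/last_ind: v t z => [|v x IH] t z; first by rewrite subseq0; case: t.
set R := first_row v; have szi := find_size (fun y => x < y) R.
rewrite first_row_rcons size_insert_in_row nth_insert_in_row -/R.
case/subseq_rconsP => [sub_t|[-> sub_t]] sorted_t.
  have [lt_t le_t] := IH _ _ sub_t sorted_t.
  split; first by rewrite -/R in lt_t; lia.
  case: eqP => // eq_i; apply: leq_trans le_t; rewrite eq_i.
  by apply/ltnW/nth_find_lt; rewrite -eq_i.
have le_i : size t <= find (fun y => x < y) R.
  case/lastP: t sub_t sorted_t => [|t y] sub_t //; rewrite sorted_leq_rcons2 => /andP [sorted_t le_yx].
  have [lt_t le_t] := IH _ _ sub_t sorted_t.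
  rewrite size_rcons ltnNge; apply/negP => le_i.
  have sortedR : sorted leq R.
    rewrite /R /first_row; case: (insertion_tableau v) (tableau_insertion v) => // R' T.
    by rewrite tableau_cons => /and4P [].
  have lt_i : find (fun y => x < y) R < size R by rewrite -/R in lt_t; lia.
  have := sorted_leq_nth leq_trans leqnn 0 sortedR _ _ _ _ le_i.
  rewrite !inE => /(_ lt_i lt_t); have := nth_find_lt lt_i; rewrite -/R in le_t *; lia.
split; first lia.
by case: eqP => // ne_i; apply: nth_lt_find; lia.
Qed.

Definition has_inc (v : seq nat) (k : nat) : Prop :=
  exists t, [/\ subseq t v, pairwise leq t & size t = k].

Lemma has_inc_first_row (v : seq nat) (k : nat) : has_inc v k <-> k <= size (first_row v).
Proof.
case: k => [|k]; first by split=> // _; exists [::]; split=> //; apply: sub0seq.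
split=> [[t []]|lt_k].
  rewrite -(sorted_pairwise leq_trans); case/lastP: t => // t z sub_t sorted_t.
  rewrite size_rcons => -[<-].
  by case: (first_row_inc sub_t sorted_t).
have [t [sub_t sorted_t sz_t]] := inc_first_row lt_k.
by exists (rcons t (nth 0 (first_row v) k)); rewrite -(sorted_pairwise leq_trans) size_rcons sz_t.
Qed.

Lemma sumn_size_insertion (v : seq nat) :
  sumn (map size (insertion_tableau v)) = size v.
Proof.
elim/last_ind: v => // v x IH; rewrite insertion_tableau_rcons size_rcons -IH.
elim: (insertion_tableau v) x => // R T IHT x /=.
by case: ifP => [lt_i|_] /=; rewrite ?size_rcons ?size_set_nth ?IHT; lia.
Qed.

Lemma sorted_shape (v : seq nat) : sorted geq (map size (insertion_tableau v)).
Proof.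
case/and3P: (tableau_insertion v) => _ _; rewrite sorted_map; apply: sub_sorted => R R'.
by case/dominatesP.
Qed.

Lemma shape_gt0 (v : seq nat) : 0 \notin map size (insertion_tableau v).
Proof.
case/and3P: (tableau_insertion v) => _ nil_T _; apply: contra nil_T.
by case/mapP => R R_T /esym/size0nil <-.
Qed.

(** * Permutations whose shape has two columns *)

(** When all parts are 1 or 2, the sum exceeds the number of parts by the number of 2s. *)
Lemma two_column_eq (m1 m2 : seq nat) :
  sorted geq m1 -> sorted geq m2 -> 0 \notin m1 -> 0 \notin m2 ->
  head 0 m1 <= 2 -> head 0 m2 <= 2 ->
  size m1 = size m2 -> sumn m1 = sumn m2 -> m1 = m2.
Proof.
have geq_trans : transitive geq by move=> y x z /= ? ?; lia.
have size_le m : 0 \notin m -> size m <= sumn m.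
  by elim: m => //= a m IH; rewrite inE negb_or => /andP [? /IH]; lia.
have le_sumn m : all (geq 1) m -> sumn m <= size m.
  by elim: m => //= a m IH /andP [? /IH]; lia.
have head_tail a m : path geq a m -> sorted geq m /\ head 0 m <= a.
  by case: m => //= b m /andP [].
elim: m1 m2 => [|a m1 IH] [|b m2] //=; rewrite !inE !negb_or.
move=> s1 s2 /andP [a0 z1] /andP [b0 z2] a2 b2 [sz] sum.
have all1 c m : c <= 1 -> path geq c m -> all (geq 1) m.
  move=> c1; rewrite (path_sortedE geq_trans) => /andP [le_c _].
  by apply: sub_all le_c => d /=; lia.
have eq_ab : a = b.
  have /= ? := size_le _ z1; have /= ? := size_le _ z2.
  case: (leqP a 1) => a1; case: (leqP b 1) => b1; try lia.
    by have := le_sumn _ (all1 _ _ a1 s1); lia.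
  by have := le_sumn _ (all1 _ _ b1 s2); lia.
have [? ?] := head_tail _ _ s1; have [? ?] := head_tail _ _ s2.
by rewrite eq_ab (IH m2) //; lia.
Qed.

Lemma conj_part2 (n : nat) (la : seq nat) (s r : nat) :
  is_partition_of n la -> conj_part la = [:: s; r] ->
  [/\ head 0 la = 2, size la = s & n = s + r].
Proof.
case/and3P => sorted_la pos_la /eqP <- def_conj.
have head2 : head 0 la = 2 by have := congr1 size def_conj; rewrite size_map size_iota.
move: def_conj; rewrite /conj_part head2 /= => -[def_s def_r].
have le2 : all (geq 2) la.
  case: la sorted_la head2 {pos_la def_s def_r} => //= a la path_la eq_a.
  move: path_la; rewrite eq_a path_sortedE => [/andP [-> //]|y x z /= ? ?]; lia.
split=> //.
  rewrite -def_s; apply/esym/eqP; rewrite -all_count; apply/allP => -[|a] //.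
  by move=> la0; rewrite la0 in pos_la.
rewrite -def_s -def_r.
elim: la le2 {sorted_la pos_la head2 def_s def_r} => //= a la IH /andP [le_a /IH ->].
by case: a le_a => [|[|[|]]] //= _; lia.
Qed.

(** The absence of an increasing triple bounds the first row by 2; the number of rows and the total
    size then fix the shape. *)
Lemma shape_two_columns (la v : seq nat) (s r : nat) :
  is_partition_of (size v) la -> conj_part la = [:: s; r] ->
  map size (insertion_tableau v) = la <->
  ~ has_inc v 3 /\ size (insertion_tableau v) = s.
Proof.
move=> part_la def_conj; have [head2 sz_la _] := conj_part2 part_la def_conj.
have head_v : head 0 (map size (insertion_tableau v)) = size (first_row v).
  by rewrite /first_row; case: (insertion_tableau v).
split=> [eq_la|[no_inc sz_v]].
  rewrite -sz_la -eq_la size_map; split=> // /has_inc_first_row.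
  by rewrite -head_v eq_la head2.
case/and3P: part_la => sorted_la pos_la /eqP sum_la.
apply: two_column_eq => //.
- exact: sorted_shape.
- exact: shape_gt0.
- by rewrite head_v leqNgt; apply/negP => /has_inc_first_row.
- by rewrite head2.
- by rewrite size_map sz_v.
- by rewrite sumn_size_insertion.
Qed.

Definition lt_ord (n : nat) : rel 'I_n := fun x y => x < y.

Lemma lt_ord_trans (n : nat) : transitive (@lt_ord n).
Proof. by move=> y x z; apply: ltn_trans. Qed.

Lemma sorted_enum_set (n : nat) (D : {set 'I_n}) : sorted (@lt_ord n) (enum D).
Proof.
apply: (subseq_sorted (@lt_ord_trans n) (filter_subseq _ _)).
by rewrite -enumT (_ : @lt_ord n = relpre val ltn) // -sorted_map val_enum_ord iota_ltn_sorted.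
Qed.

Lemma pairwise_enum_set (n : nat) (D : {set 'I_n}) (R : rel 'I_n) :
  (forall x y : 'I_n, x \in D -> y \in D -> x < y -> R x y) -> pairwise R (enum D).
Proof.
move=> RD; have := sorted_enum_set D; rewrite (sorted_pairwise (@lt_ord_trans n)).
have : all [in D] (enum D) by apply/allP => x; rewrite mem_enum.
elim: (enum D) => //= a u IH /andP [a_D all_D] /andP [/allP lt_a pw_u].
rewrite IH // andbT; apply/allP => b b_u; apply: RD => //; first exact: (allP all_D).
exact: lt_a.
Qed.

Lemma pairwise_lt_rel (n : nat) (R : rel 'I_n) (u : seq 'I_n) (x y : 'I_n) :
  pairwise (@lt_ord n) u -> pairwise R u -> x \in u -> y \in u -> x < y -> R x y.
Proof.
elim: u => //= a u IH /andP [/allP lt_a pw_lt] /andP [/allP R_a pw_R].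
rewrite !inE => /predU1P [->|x_u] /predU1P [->|y_u]; rewrite ?ltnn //.
- by move=> _; apply: R_a.
- by have := lt_a x x_u; rewrite /lt_ord => lt_ax lt_xa; lia.
- exact: IH.
Qed.

(** Stated for any [R] so as to serve increasing and decreasing subsequences alike. *)
Lemma subseq_one_line (n : nat) (R : rel nat) (pi : 'S_n) (k : nat) :
  (exists t, [/\ subseq t (one_line pi), pairwise R t & size t = k]) <->
  (exists2 D : {set 'I_n}, #|D| = k &
     forall x y, x \in D -> y \in D -> x < y -> R (pi x) (pi y)).
Proof.
split=> [[t [/subseqP [m _ ->]]]|[D <- RD]].
  rewrite -map_mask size_map pairwise_map; set u := mask m _ => pw_u sz_u.
  have uniq_u : uniq u by rewrite mask_uniq ?enum_uniq.
  exists [set x in u]; first by rewrite cardsE (card_uniqP uniq_u).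
  move=> x y; rewrite !inE => x_u y_u.
  apply: (pairwise_lt_rel _ pw_u x_u y_u).
  apply: (subseq_pairwise (mask_subseq _ _)).
  have := sorted_enum_set [set: 'I_n]; rewrite (sorted_pairwise (@lt_ord_trans n)).
  by rewrite (eq_enum (B := 'I_n)) // => z; rewrite inE.
exists [seq val (pi x) | x <- enum D]; split; last by rewrite size_map -cardE.
  by apply: map_subseq; rewrite [enum D]/enum_mem -enumT; apply: filter_subseq.
by rewrite pairwise_map; apply: pairwise_enum_set.
Qed.

Definition dec_on (n : nat) (pi : 'S_n) (D : {set 'I_n}) : Prop :=
  forall x y, x \in D -> y \in D -> x < y -> pi y < pi x.

Lemma mem_W (n : nat) (la : seq nat) (s r : nat) (pi : 'S_n) :
  is_partition_of n la -> conj_part la = [:: s; r] ->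
  pi \in W n la <->
  [/\ forall x y z : 'I_n, x < y < z -> ~~ (pi x < pi y < pi z),
      exists2 D : {set 'I_n}, #|D| = s & dec_on pi D &
      forall D : {set 'I_n}, dec_on pi D -> #|D| <= s].
Proof.
move=> part_la def_conj; set v := one_line pi.
have sz_v : size v = n by rewrite size_map size_enum_ord.
(* The values of a permutation are distinct, so weak and strict increase agree. *)
have lt_le (x y : 'I_n) : x < y -> (pi x <= pi y) = (pi x < pi y).
  by move=> lt_xy; rewrite leq_eqVlt (inj_eq val_inj) (inj_eq perm_inj) -val_eqE ltn_eqF.
have has_decP k : has_dec v k <-> exists2 D : {set 'I_n}, #|D| = k & dec_on pi D.
  exact: (subseq_one_line gtn).
have no_incP : ~ has_inc v 3 <->
    forall x y z : 'I_n, x < y < z -> ~~ (pi x < pi y < pi z).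
  rewrite /has_inc (subseq_one_line leq); split=> [no_inc x y z|no_inc [D card_D inc_D]].
    move=> /andP [lt_xy lt_yz]; apply/negP => /andP [lt_pxy lt_pyz]; apply: no_inc.
    exists [set x; y; z].
      by rewrite setUC cardsU1 !inE cards2 -!val_eqE /=; lia.
    move=> a b; rewrite !inE -!orbA => /or3P [] /eqP-> /or3P [] /eqP-> //=; lia.
  move: card_D (sorted_enum_set D) inc_D; rewrite cardE.
  have mem_D x : x \in enum D -> x \in D by rewrite mem_enum.
  case: (enum D) mem_D => [|x [|y [|z [|]]]] //= mem_D _ /and3P [xy yz _] inc_D.
  have := no_inc x y z; rewrite [x < y]xy [y < z]yz => /(_ isT) /negP; apply.
  by rewrite -!lt_le // !inc_D // mem_D // !inE eqxx ?orbT.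
rewrite inE /sh -/v.
have := @shape_two_columns la v s r; rewrite sz_v => /(_ part_la def_conj).
rewrite no_incP => shE.
split=> [/eqP/shE [no_inc sz]|[no_inc ex_D max_D]].
  split=> // [|D dec_D]; first by apply/has_decP; rewrite -sz; apply: has_dec_size_insertion.
  by rewrite -sz; apply: size_insertion_tableau; apply/has_decP; exists D.
apply/eqP/shE; split=> //; apply/eqP; rewrite eqn_leq; apply/andP; split; last first.
  exact/size_insertion_tableau/has_decP.
by have /has_decP [D <- /max_D] := has_dec_size_insertion v.
Qed.

(** * Non-inversions and areas *)

(** The size of the Young diagram cut off by the lattice path whose steps record membership in
    [P]. *)
Definition area (n : nat) (P : {set 'I_n}) : nat :=
  #|[set xy : 'I_n * 'I_n | [&& xy.1 \in P, xy.2 \notin P & xy.2 < xy.1]]|.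

Definition noninv (n : nat) (pi : 'S_n) : nat :=
  #|[set xy : 'I_n * 'I_n | (xy.1 < xy.2) && (pi xy.1 < pi xy.2)]|.

Lemma cardE_sum (T : finType) (A : {set T}) : #|A| = \sum_x (x \in A).
Proof. by rewrite -sum1_card big_mkcond; apply: eq_bigr => x _; case: (x \in A). Qed.

Lemma inv_noninv (n : nat) (pi : 'S_n) :
  Defs.inv pi + noninv pi = #|[set xy : 'I_n * 'I_n | xy.1 < xy.2]|.
Proof.
rewrite /Defs.inv /noninv !cardE_sum -big_split /=; apply: eq_bigr => -[x y] _; rewrite !inE /=.
case: (ltnP x y) => //= lt_xy.
have : pi x != pi y by rewrite (inj_eq perm_inj) -val_eqE ltn_eqF.
by rewrite -val_eqE /=; case: ltngtP.
Qed.

Section Areas.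

Variables (n : nat) (pi : 'S_n) (P : {set 'I_n}).
Hypotheses (dec_P : dec_on pi P) (dec_P' : dec_on pi (~: P)).

Lemma area_imset :
  area (pi @: P) = #|[set xy : 'I_n * 'I_n | [&& xy.1 \in P, xy.2 \notin P & pi xy.2 < pi xy.1]]|.
Proof.
rewrite /area -[RHS](card_imset _ (f := fun xy => (pi xy.1, pi xy.2))); last first.
  by move=> [x y] [x' y'] [/perm_inj-> /perm_inj->].
apply: eq_card => -[x y]; rewrite !inE /=; apply/idP/imsetP => [|[[a b] + [-> ->]]].
  case/and3P=> /imsetP [a a_P ->]; rewrite -(permKV pi y) (mem_imset _ _ perm_inj) => b_P lt_ba.
  by exists (a, (pi^-1)%g y); rewrite ?inE //= a_P b_P.
by rewrite inE /= !(mem_imset _ _ perm_inj).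
Qed.

(** The pairs across [P] and its complement that are not non-inversions starting in [P]. *)
Let unordered : {set 'I_n * 'I_n} := [set xy | [&& xy.1 \in P, xy.2 \notin P &
  (xy.2 < xy.1) || (pi xy.2 < pi xy.1)]].

Let card_unordered : #|unordered| <= area P + area (pi @: P).
Proof.
rewrite area_imset; apply: leq_trans (leq_card_setU _ _); apply: subset_leq_card.
apply/subsetP => -[x y]; rewrite !inE /=.
by case: (x \in P) => //=; case: (y \in P).
Qed.

(** A decreasing set contains no non-inversion, so all its pairs across [P] are unordered. *)
Lemma dec_on_area (D : {set 'I_n}) :
  dec_on pi D -> #|D :&: P| * #|D :\: P| <= area P + area (pi @: P).
Proof.
move=> dec_D; apply: leq_trans card_unordered; rewrite -cardsX; apply: subset_leq_card.
apply/subsetP => -[x y]; rewrite !inE /= => /andP [/andP [x_D x_P] /andP [y_P y_D]].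
rewrite x_P y_P /=; case: (ltngtP x y) => // [lt_xy|/val_inj eq_xy].
  exact: dec_D.
by rewrite -eq_xy x_P in y_P.
Qed.

(** If [x], [y] were out of order both in position and in value, then every [z] in [P] would form an
    unordered pair with [y]: either [y < z], or [z < x] and [pi z] exceeds [pi x]. That makes [#|P|]
    pairs, too many. *)
Lemma area_no_overlap (x y : 'I_n) :
  area P + area (pi @: P) < #|P| -> x \in P -> y \notin P -> y < x -> ~~ (pi y < pi x).
Proof.
move=> small x_P y_P lt_yx; apply/negP => lt_pyx.
suff : #|P| <= #|unordered| by have := card_unordered; lia.
rewrite -(card_imset P (f := fun z => (z, y))); last by move=> a b [].
apply: subset_leq_card; apply/subsetP => _ /imsetP [z z_P ->]; rewrite inE /= z_P y_P /=.
case: (ltnP y z) => //= le_zy; apply: (ltn_trans lt_pyx).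
by apply: dec_P => //; lia.
Qed.

(** Otherwise [x] would form an unordered pair with every element of the complement. *)
Lemma area_edge (x : 'I_n) :
  area P + area (pi @: P) < #|~: P| -> x \in P -> exists2 y : 'I_n, x < y & pi x < pi y.
Proof.
move=> small x_P.
have [/existsP [y /andP [? ?]]|] := boolP [exists y : 'I_n, (x < y) && (pi x < pi y)].
  by exists y.
rewrite negb_exists => /forallP no_edge.
suff : #|~: P| <= #|unordered| by have := card_unordered; lia.
rewrite -(card_imset (~: P) (f := fun z => (x, z))); last by move=> a b [].
apply: subset_leq_card; apply/subsetP => _ /imsetP [y + ->]; rewrite !inE /= x_P => y_P.
rewrite y_P /=; have := no_edge y.
have ne_xy : x != y by apply: contraNneq y_P => <-.
have : pi x != pi y by rewrite (inj_eq perm_inj).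
by move: ne_xy; rewrite -!val_eqE /=; lia.
Qed.

(** The hypothesis excludes at once the non-inversions starting outside [P] and the pairs counted by
    both areas. Hence each pair across [P] is counted exactly once on the left. *)
Lemma noninv_area :
  (forall x y : 'I_n, x \in P -> y \notin P -> y < x -> ~~ (pi y < pi x)) ->
  noninv pi + area P + area (pi @: P) = #|P| * (n - #|P|).
Proof.
move=> no_overlap.
have card_P' : #|~: P| = n - #|P| by rewrite cardsCs setCK card_ord.
rewrite area_imset -card_P' -cardsX /noninv /area !cardE_sum -!big_split /=.
apply: eq_bigr => -[x y] _; rewrite !inE /=.
have ne_pi : x != y -> pi x != pi y by rewrite (inj_eq perm_inj).
have eq_xy : x = y -> (x < y) = false by move=> ->; rewrite ltnn.
have mem_ne : x \in P -> y \notin P -> x != y by move=> x_P; apply: contraNneq => <-.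
have ovl := @no_overlap x y; have ovl' := @no_overlap y x.
have dec := @dec_P x y; have dec' := @dec_P' x y; rewrite !inE in dec'.
move: ne_pi mem_ne ovl ovl' dec dec'; rewrite -!val_eqE /=.
case: (x \in P); case: (y \in P) => /=; lia.
Qed.

End Areas.

(** * Permutations glued from two decreasing maps *)

Lemma dec_on_eq (n : nat) (pi sigma : 'S_n) (P : {set 'I_n}) :
  dec_on pi P -> dec_on sigma P -> pi @: P = sigma @: P -> {in P, pi =1 sigma}.
Proof.
move=> dec_pi dec_sigma eq_im.
have sorted_dec (tau : 'S_n) : dec_on tau P ->
    sorted (fun x y => lt_ord y x) (map tau (enum P)).
  by move=> dec_tau; apply: pairwise_sorted; rewrite pairwise_map; apply: pairwise_enum_set.
(* Both lists enumerate the common image in decreasing order. *)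
have /eq_in_map eq_pi : map pi (enum P) = map sigma (enum P).
  apply: irr_sorted_eq (sorted_dec _ dec_pi) (sorted_dec _ dec_sigma) _ => [y x z xy yz|x|x].
  - exact: lt_ord_trans yz xy.
  - exact: ltnn.
  have memE (tau : 'S_n) : (x \in map tau (enum P)) = (x \in tau @: P).
    apply/mapP/imsetP => [] [y y_P ->]; exists y => //; first by rewrite -mem_enum.
    by rewrite mem_enum.
  by rewrite !memE eq_im.
by move=> x x_P; apply: eq_pi; rewrite mem_enum.
Qed.

Lemma decreasing_map (n : nat) (A B : {set 'I_n}) : #|A| = #|B| ->
  exists g : 'I_n -> 'I_n, (forall x, x \in A -> g x \in B) /\
    forall x y : 'I_n, x \in A -> y \in A -> x < y -> g y < g x.
Proof.
(* The k-th smallest element of [A] goes to the k-th largest of [B]; the default [x] is never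
   reached on [A]. *)
move=> eq_card; pose g x := nth x (rev (enum B)) (index x (enum A)).
have lt_index x : x \in A -> index x (enum A) < size (rev (enum B)).
  by move=> x_A; rewrite size_rev -cardE -eq_card cardE index_mem mem_enum.
exists g; split=> [x x_A|x y x_A y_A lt_xy].
  by rewrite -mem_enum -mem_rev mem_nth ?lt_index.
have lt_idx : index x (enum A) < index y (enum A).
  rewrite ltnNge leq_eqVlt; apply/negP => /orP [/eqP eq_idx|lt_idx].
    have eq_xy : y = x by apply: (index_inj x _ _ eq_idx); rewrite mem_enum.
    by rewrite eq_xy ltnn in lt_xy.
  have := sorted_ltn_index (@lt_ord_trans n) (sorted_enum_set A).
  move=> /(_ y x); rewrite !mem_enum => /(_ y_A x_A lt_idx); rewrite /lt_ord; lia.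
rewrite /g (set_nth_default x y) ?lt_index //.
have sorted_rev : sorted (fun x y => lt_ord y x) (rev (enum B)).
  by rewrite rev_sorted; apply: sorted_enum_set.
apply: (sorted_ltn_nth _ x sorted_rev); rewrite ?inE ?lt_index // => b a c ab bc.
exact: lt_ord_trans bc ab.
Qed.

Lemma perm_of_sets (n : nat) (P V : {set 'I_n}) : #|P| = #|V| ->
  exists pi : 'S_n, [/\ dec_on pi P, dec_on pi (~: P) & pi @: P = V].
Proof.
move=> eq_card; have [g [g_V dec_g]] := decreasing_map eq_card.
have eq_card' : #|~: P| = #|~: V| by rewrite [LHS]cardsCs [RHS]cardsCs !setCK eq_card.
have [h [h_V dec_h]] := decreasing_map eq_card'.
pose f x := if x \in P then g x else h x.
have f_V x : (f x \in V) = (x \in P).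
  rewrite /f; case: ifP => [/g_V //|/negbT x_P].
  by apply/negbTE; have := h_V x; rewrite !inE; apply.
have dec_f (x y : 'I_n) : (x \in P) = (y \in P) -> x < y -> f y < f x.
  rewrite /f => eq_P lt_xy; rewrite -eq_P; case: ifP => x_P.
    by apply: dec_g; rewrite -?eq_P.
  by apply: dec_h; rewrite ?inE -?eq_P ?x_P.
have inj_f : injective f.
  move=> x y eq_f; have eq_P : (x \in P) = (y \in P) by rewrite -!f_V eq_f.
  apply/val_inj/eqP; case: ltngtP => // lt_xy.
    by have := dec_f x y eq_P lt_xy; rewrite eq_f ltnn.
  by have := dec_f y x (esym eq_P) lt_xy; rewrite eq_f ltnn.
exists (perm inj_f); split.
- by move=> x y x_P y_P; rewrite !permE; apply: dec_f; rewrite x_P y_P.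
- move=> x y; rewrite !inE !permE => x_P y_P; apply: dec_f.
  by rewrite (negbTE x_P) (negbTE y_P).
apply/eqP; rewrite eqEcard card_imset ?eq_card ?leqnn ?andbT; last exact: perm_inj.
by apply/subsetP => _ /imsetP [x x_P ->]; rewrite permE f_V.
Qed.

(** * The set of positions that start a non-inversion *)

Definition lower_set (n : nat) (pi : 'S_n) : {set 'I_n} :=
  [set x : 'I_n | [exists y : 'I_n, (x < y) && (pi x < pi y)]].

Lemma lower_set_no_overlap (n : nat) (pi : 'S_n) (x y : 'I_n) :
  y \notin lower_set pi -> y < x -> ~~ (pi y < pi x).
Proof.
rewrite inE negb_exists => /forallP /(_ x) + lt_yx.
by rewrite lt_yx.
Qed.

(** An increase inside the set would extend to an increasing triple, and one outside would put its
    first position into the set. *)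
Lemma dec_on_lower_set (n : nat) (pi : 'S_n) :
  (forall x y z : 'I_n, x < y < z -> ~~ (pi x < pi y < pi z)) ->
  dec_on pi (lower_set pi) /\ dec_on pi (~: lower_set pi).
Proof.
move=> no_inc.
have lt_neg (x y : 'I_n) : x < y -> ~~ (pi x < pi y) -> pi y < pi x.
  move=> lt_xy; have : pi x != pi y by rewrite (inj_eq perm_inj) -val_eqE ltn_eqF.
  by rewrite -val_eqE /=; case: ltngtP.
split=> x y; rewrite !inE => x_L y_L lt_xy; apply: lt_neg => //; last first.
  by move: x_L; rewrite negb_exists => /forallP /(_ y); rewrite lt_xy.
have /existsP [z /andP [lt_yz lt_pyz]] := y_L.
by have := no_inc x y z; rewrite lt_xy lt_yz lt_pyz !andbT => /(_ isT).
Qed.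

(** This recovers [P] from [pi]: [area_no_overlap] keeps positions outside [P] from starting a
    non-inversion, and [area_edge] makes every position of [P] start one. *)
Lemma lower_setP (n : nat) (pi : 'S_n) (P : {set 'I_n}) :
  dec_on pi P -> dec_on pi (~: P) ->
  area P + area (pi @: P) < #|P| -> area P + area (pi @: P) < #|~: P| ->
  lower_set pi = P.
Proof.
move=> dec_P dec_P' small small'; apply/setP => x; rewrite inE.
apply/existsP/idP => [[y /andP [lt_xy lt_pxy]]|x_P].
  apply/negPn/negP => x_P; case: (boolP (y \in P)) => y_P.
    by have := area_no_overlap dec_P small y_P x_P lt_xy; rewrite lt_pxy.
  by have := dec_P' x y; rewrite !inE x_P y_P => /(_ isT isT lt_xy); lia.
by have [y lt_xy lt_pxy] := area_edge small' x_P; exists y; rewrite lt_xy.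
Qed.

(** The set [L] and its complement are decreasing, so [#|L|] lies between [r] and [s]. The product
    over [L] may then exceed [s * r], but the pairs across [L] inside a decreasing set of size [s]
    are lost, which outweighs the gain. *)
Lemma noninv_bound (n : nat) (pi : 'S_n) (s r : nat) (L := lower_set pi) :
  n = s + r -> r <= s ->
  (forall x y z : 'I_n, x < y < z -> ~~ (pi x < pi y < pi z)) ->
  (exists2 D : {set 'I_n}, #|D| = s & dec_on pi D) ->
  (forall D : {set 'I_n}, dec_on pi D -> #|D| <= s) ->
  noninv pi <= s * r /\
  (s * r < noninv pi + r -> (#|L| == r) || (#|L| == s)).
Proof.
move=> def_n le_rs no_inc [D card_D dec_D] max_D.
have [dec_L dec_L'] := dec_on_lower_set no_inc.
have := noninv_area dec_L dec_L' (fun x y _ => @lower_set_no_overlap n pi x y).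
have := dec_on_area L dec_D.
have card_L' : #|~: L| = n - #|L| by rewrite cardsCs setCK card_ord.
have := max_D _ dec_L; have := max_D _ dec_L'; rewrite -/L card_L'.
have -> : n - #|L| = s + r - #|L| by lia.
have := cardsID L D; rewrite card_D.
have : #|D :&: L| <= #|L| by apply/subset_leq_card/subsetIr.
have : #|D :\: L| <= s + r - #|L|.
  by rewrite -def_n -card_L'; apply: subset_leq_card; rewrite setDE subsetIr.
move: #|D :&: L| #|D :\: L| #|L| (area _) (area _) (noninv _) => i j l b a c.
move=> le_j le_i eq_ij le_l' le_l le_ab eq_c.
(* With [l = r + t] and [s = l + u], the product [l * (s + r - l)] is [s * r + t * u]. *)
have [t def_l] : exists t, l = r + t by exists (l - r); lia.
have [u def_s] : exists u, s = l + u by exists (s - l); lia.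
have [e def_i] : exists e, i = t + e by exists (i - t); lia.
have [f def_j] : exists f, j = u + f by exists (j - u); lia.
have def_r : r = e + f by lia.
have {}eq_c : c + (a + b) = s * r + t * u.
  rewrite addnA eq_c def_s (_ : l + u + r - l = u + r); last lia.
  by rewrite def_l; ring.
have {}le_ab : t * u + (t * f + e * u) <= a + b.
  by apply: leq_trans le_ab; rewrite def_i def_j mulnDl !mulnDr; lia.
split; first lia.
move=> big.
(* If [t] and [u] are both positive, the deficit is at least [t * f + e * u >= f + e = r]. *)
have [t0|t_gt0] := posnP t; first by rewrite def_l t0 addn0 eqxx.
have [u0|u_gt0] := posnP u; first by rewrite def_s u0 addn0 eqxx orbT.
by have := leq_pmull f t_gt0; have := leq_pmulr e u_gt0; lia.
Qed.

(** * Counting sets by area *)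

Definition set_cons (n : nat) (bQ : bool * {set 'I_n}) : {set 'I_n.+1} :=
  [set x | if unlift ord0 x is Some y then y \in bQ.2 else bQ.1].

Lemma set_cons0 (n : nat) (b : bool) (Q : {set 'I_n}) : (ord0 \in set_cons (b, Q)) = b.
Proof. by rewrite inE unlift_none. Qed.

Lemma set_consS (n : nat) (b : bool) (Q : {set 'I_n}) (x : 'I_n) :
  (lift ord0 x \in set_cons (b, Q)) = (x \in Q).
Proof. by rewrite inE liftK. Qed.

Lemma set_cons_bij (n : nat) : bijective (@set_cons n).
Proof.
exists (fun P : {set 'I_n.+1} => (ord0 \in P, [set x : 'I_n | lift ord0 x \in P])) => [[b Q]|P].
  by rewrite set_cons0; congr (_, _); apply/setP => x; rewrite inE set_consS.
apply/setP => x; case: (unliftP ord0 x) => [y|] ->; last by rewrite set_cons0.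
by rewrite set_consS inE.
Qed.

Lemma card_set_cons (n : nat) (b : bool) (Q : {set 'I_n}) :
  #|set_cons (b, Q)| = b + #|Q|.
Proof.
rewrite !cardE_sum big_ord_recl set_cons0; congr (_ + _).
by apply: eq_bigr => x _; rewrite set_consS.
Qed.

Lemma area_sum (n : nat) (P : {set 'I_n}) :
  area P = \sum_(x < n) \sum_(y < n) [&& x \in P, y \notin P & y < x].
Proof.
rewrite /area cardE_sum pair_big /=.
by apply: eq_bigr => -[x y] _; rewrite inE.
Qed.

(* Prepending a smallest element outside [Q] creates one new pair per element of [Q]. *)
Lemma area_set_cons (n : nat) (b : bool) (Q : {set 'I_n}) :
  area (set_cons (b, Q)) = ~~ b * #|Q| + area Q.
Proof.
rewrite !area_sum big_ord_recl big1 => [|y _]; last by rewrite ltn0 !andbF.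
rewrite add0n cardE_sum big_distrr -big_split /=; apply: eq_bigr => x _.
rewrite big_ord_recl set_consS set_cons0 /=; congr (_ + _).
  by rewrite andbT; case: b; case: (x \in Q).
by apply: eq_bigr => y _; rewrite set_consS.
Qed.

Section AreaPolynomials.

Local Open Scope ring_scope.

(** The Gaussian binomial coefficient of [n] over [a]. *)
Definition area_poly (n a : nat) : {poly nat} :=
  \sum_(P : {set 'I_n} | #|P| == a) 'X^(area P).

Lemma area_poly0 (n : nat) : area_poly n 0 = 1.
Proof.
rewrite /area_poly (big_pred1 set0) => [|P]; last by rewrite cards_eq0.
by rewrite area_sum big1 ?expr0 // => x _; rewrite big1 // => y _; rewrite inE.
Qed.

(** The q-Pascal rule: split by whether the least element belongs to the set. *)
Lemma area_polyS (n a : nat) :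
  area_poly n.+1 a.+1 = area_poly n a + 'X^(a.+1) * area_poly n a.+1.
Proof.
rewrite /area_poly (reindex _ (onW_bij _ (set_cons_bij n))) /=.
rewrite big_mkcond /=.
rewrite -(pair_big xpredT xpredT (fun b Q => if #|set_cons (b, Q)| == a.+1
   then 'X^(area (set_cons (b, Q))) else 0)) /= big_bool /=; congr (_ + _).
  rewrite -big_mkcond; apply: eq_big => Q; first by rewrite card_set_cons.
  by rewrite area_set_cons mul0n.
rewrite -big_mkcond big_distrr; apply: eq_big => Q; first by rewrite card_set_cons.
by rewrite card_set_cons area_set_cons mul1n => /eqP <-; rewrite exprD.
Qed.

(** The generating function of partitions into parts at most [a], with each geometric series cut
    after multiplicity [D]; it is exact up to degree [D]. *)
Definition mult_poly (D a : nat) : {poly nat} :=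
  \prod_(k < a) \sum_(j < D.+1) 'X^(k.+1 * j).

Lemma coef_mult_polyS (D a m : nat) : (m <= D)%N ->
  (mult_poly D a.+1)`_m =
  (mult_poly D a)`_m + (if (m <= a)%N then 0 else (mult_poly D a.+1)`_(m - a.+1)).
Proof.
move=> le_mD; set H := mult_poly D a; set H' := mult_poly D a.+1.
(* The telescoped geometric sum, arranged without subtraction because the coefficients are natural
   numbers. The cut-off term has degree above [D]. *)
have eqH : H' + H * 'X^(a.+1 * D.+1) = H + 'X^(a.+1) * H'.
  rewrite /H' /mult_poly big_ord_recr /= -/(mult_poly D a) -/H.
  rewrite mulrCA -mulrDr -{2}[H]mulr1 -mulrDr; congr (_ * _).
  transitivity (\sum_(j < D.+2) 'X^(a.+1 * j) : {poly nat}); first by rewrite [RHS]big_ord_recr.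
  rewrite big_ord_recl muln0 expr0 big_distrr /=; congr (_ + _); apply: eq_bigr => j _.
  by rewrite -exprD -mulnS.
have := congr1 (fun q : {poly nat} => q`_m) eqH.
rewrite !coefD coefMXn coefXnM ltnS.
by rewrite (_ : (m < a.+1 * D.+1)%N) ?addr0 //; apply: leq_trans (leq_pmull _ _).
Qed.

(** A part exceeding [D] cannot occur in degree at most [D]. *)
Lemma coef_mult_poly_stable (D a m : nat) : (m <= D <= a)%N ->
  (mult_poly D a)`_m = (mult_poly D D)`_m.
Proof.
case/andP => le_mD /subnK <-; elim: (a - D)%N => // k IH.
rewrite addSn coef_mult_polyS // IH ifT ?addr0 //.
exact: leq_trans le_mD (leq_addl _ _).
Qed.

(** A partition of [m] has at most [n - a] parts, so the [a] by [n - a] box imposes only the bound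
    [a] on the parts. Formally, both sides obey the same recurrence. *)
Lemma coef_area_poly (D n a m : nat) : (a <= n)%N -> (m <= n - a)%N -> (m <= D)%N ->
  (area_poly n a)`_m = (mult_poly D a)`_m.
Proof.
elim: n a m => [|n IH] [|a] m // le_an le_m le_mD.
- by rewrite area_poly0 /mult_poly big_ord0.
- by rewrite area_poly0 /mult_poly big_ord0.
rewrite area_polyS coef_mult_polyS // coefD coefXnM ltnS IH //; congr (_ + _).
case: leqP => // lt_am; apply: IH; lia.
Qed.

Lemma p2E (D : nat) : p 2 D = (mult_poly D D ^+ 2)`_D.
Proof.
rewrite /mult_poly -prodrXl.
(* Writing each square as a product over two colours makes the expansion yield one monomial per
   multiplicity function. *)
rewrite (eq_bigr (fun k : 'I_D => \prod_(c < 2) \sum_(j < D.+1) 'X^(k.+1 * j))); last first.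
  by move=> k _; rewrite big_ord_recl big_ord1 expr2.
rewrite pair_big /= bigA_distr_bigA /= coef_sum /p -sum1dep_card big_mkcond /=.
apply: eq_bigr => f _; rewrite -expr_sum coefXn eq_sym.
by case: eqP.
Qed.

Lemma coef_area_poly_sqr (n a D : nat) :
  #|[set PV : {set 'I_n} * {set 'I_n} |
     [&& #|PV.1| == a, #|PV.2| == a & area PV.1 + area PV.2 == D]%N]| =
  (area_poly n a ^+ 2)`_D.
Proof.
rewrite /area_poly expr2 big_distrlr /= pair_big /= coef_sum.
rewrite -sum1dep_card [LHS]big_mkcond [RHS]big_mkcond /=.
apply: eq_bigr => -[P V] _ /=; rewrite -exprD coefXn [D == _]eq_sym.
by case: (#|P| == a); case: (#|V| == a); case: eqP.
Qed.

(** Only coefficients of degree at most [D] enter the squares, and there the two polynomials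
    agree. *)
Lemma card_pairs_of_sets (n a D : nat) : (D <= a)%N -> (a <= n)%N -> (D <= n - a)%N ->
  #|[set PV : {set 'I_n} * {set 'I_n} |
     [&& #|PV.1| == a, #|PV.2| == a & area PV.1 + area PV.2 == D]%N]| = p 2 D.
Proof.
move=> le_Da le_an le_Dna; rewrite coef_area_poly_sqr p2E !expr2 !coefM.
have eq_coef i : (i <= D)%N -> (area_poly n a)`_i = (mult_poly D D)`_i.
  move=> le_iD; rewrite (coef_area_poly (D := D)) ?coef_mult_poly_stable ?le_iD //.
  exact: leq_trans le_Dna.
by apply: eq_bigr => i _; rewrite !eq_coef ?leq_subr ?leq_ord.
Qed.

End AreaPolynomials.

(** * Permutations of small excess *)

Section TwoColumns.

Variables (n : nat) (la : seq nat) (s r : nat).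
Hypotheses (part_la : is_partition_of n la) (def_conj : conj_part la = [:: s; r])
  (le_rs : r <= s).

Let def_n : n = s + r. Proof. by case: (conj_part2 part_la def_conj). Qed.

Let mul_complement (l : nat) : (l == r) || (l == s) -> l * (n - l) = s * r.
Proof. by case/orP => /eqP ->; rewrite def_n ?addnK ?addKn // mulnC. Qed.

Lemma noninv_W (pi : 'S_n) : pi \in W n la -> noninv pi <= s * r.
Proof.
by case/(mem_W _ part_la def_conj) => no_inc ex_D max_D; case: (noninv_bound def_n le_rs no_inc ex_D max_D).
Qed.

Lemma card_lower_set_W (pi : 'S_n) (Delta : nat) :
  pi \in W n la -> noninv pi + Delta = s * r -> Delta < r ->
  let L := lower_set pi in
  [/\ dec_on pi L, dec_on pi (~: L), (#|L| == r) || (#|L| == s) &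
      area L + area (pi @: L) = Delta].
Proof.
case/(mem_W _ part_la def_conj) => no_inc ex_D max_D eq_noninv lt_Delta L.
have [dec_L dec_L'] := dec_on_lower_set no_inc.
have [_ card_L] := noninv_bound def_n le_rs no_inc ex_D max_D.
have {}card_L : (#|L| == r) || (#|L| == s) by apply: card_L; lia.
split=> //.
have := noninv_area dec_L dec_L' (fun x y _ => @lower_set_no_overlap n pi x y).
by rewrite -/L mul_complement // -eq_noninv; lia.
Qed.

(** Any increase goes from [P] to its complement, which rules out increasing triples; [P] or its
    complement is a decreasing set of size [s]. *)
Lemma W_of_small_area (pi : 'S_n) (P : {set 'I_n}) (Delta : nat) :
  dec_on pi P -> dec_on pi (~: P) -> (#|P| == r) || (#|P| == s) ->
  area P + area (pi @: P) = Delta -> Delta < r ->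
  [/\ pi \in W n la, noninv pi + Delta = s * r & lower_set pi = P].
Proof.
move=> dec_P dec_P' card_P eq_Delta lt_Delta.
have card_P' : #|~: P| = n - #|P| by rewrite cardsCs setCK card_ord.
have small : area P + area (pi @: P) < #|P| by case/orP: card_P => /eqP; lia.
have small' : area P + area (pi @: P) < #|~: P| by case/orP: card_P => /eqP; lia.
split; last exact: lower_setP.
  apply/(mem_W _ part_la def_conj); split=> [x y z|| D dec_D].
  - move=> /andP [lt_xy lt_yz]; apply/negP => /andP [lt_pxy lt_pyz].
    have y_P : y \in P.
      apply/negPn/negP => y_P; case: (boolP (z \in P)) => z_P.
        by have := area_no_overlap dec_P small z_P y_P lt_yz; rewrite lt_pyz.
      by have := dec_P' y z; rewrite !inE => /(_ y_P z_P lt_yz); lia.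
    case: (boolP (x \in P)) => x_P; first by have := dec_P x y x_P y_P lt_xy; lia.
    by have := area_no_overlap dec_P small y_P x_P lt_xy; rewrite lt_pxy.
  - case/orP: (card_P) => /eqP eq_P; last by exists P.
    by exists (~: P) => //; rewrite card_P' eq_P; lia.
  have := dec_on_area P dec_D; rewrite eq_Delta => small_D.
  have := cardsID P D.
  have : #|D :&: P| <= #|P| by apply/subset_leq_card/subsetIr.
  have : #|D :\: P| <= n - #|P| by rewrite -card_P'; apply: subset_leq_card; rewrite setDE subsetIr.
  (* If both pieces of [D] are nonempty, their product is at least [#|D| - 1], so [#|D| > s] would
     give at least [s >= r > Delta] pairs. *)
  case: #|D :&: P| #|D :\: P| small_D => [|i] [|j] small_D; by case/orP: card_P => /eqP; lia.
rewrite -eq_Delta addnA noninv_area // => [|x y]; last exact: area_no_overlap.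
exact: mul_complement.
Qed.

(** Sending [pi] to its lower set and the image of that set is a bijection onto the pairs of
    [a]-sets of total area [Delta]: [pi] is decreasing on the set and on its complement, hence
    determined by the images. *)
Lemma card_W_lower_set (a Delta : nat) : (a == r) || (a == s) -> Delta < r ->
  #|[set pi in W n la | (noninv pi + Delta == s * r) && (#|lower_set pi| == a)]| = p 2 Delta.
Proof.
move=> a_rs lt_Delta.
rewrite -(@card_pairs_of_sets n a Delta); try by case/orP: a_rs => /eqP; lia.
rewrite -(card_in_imset (f := fun pi : 'S_n => (lower_set pi, pi @: lower_set pi))).
  apply: eq_card => -[P V]; rewrite inE /=; apply/imsetP/and3P.
    move=> [pi]; rewrite inE => /and3P [W_pi /eqP eq_pi /eqP card_L] [-> ->].
    have [_ _ _ ->] := card_lower_set_W W_pi eq_pi lt_Delta.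
    by rewrite card_imset ?card_L; last exact: perm_inj.
  move=> [/eqP card_P /eqP card_V /eqP eq_Delta].
  have [|pi [dec_P dec_P' def_V]] := @perm_of_sets n P V; first by rewrite card_V.
  have [||W_pi eq_pi L_pi] := @W_of_small_area pi P Delta dec_P dec_P' _ _ lt_Delta.
  - by rewrite card_P.
  - by rewrite def_V.
  exists pi; last by rewrite L_pi def_V.
  by rewrite inE W_pi eq_pi L_pi card_P !eqxx.
move=> pi sigma /setIdP [W_pi /andP [/eqP eq_pi _]] /setIdP [W_sigma /andP [/eqP eq_sigma _]].
case=> eq_L eq_im.
have [dec1 dec1' _ _] := card_lower_set_W W_pi eq_pi lt_Delta.
have [dec2 dec2' _ _] := card_lower_set_W W_sigma eq_sigma lt_Delta.
rewrite -eq_L in dec2 dec2' eq_im.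
apply/permP => x; case: (boolP (x \in lower_set pi)) => x_L.
  exact: dec_on_eq dec1 dec2 eq_im x x_L.
apply: (dec_on_eq dec1' dec2' _ (x := x)); last by rewrite inE.
have imC (tau : 'S_n) (A : {set 'I_n}) : tau @: (~: A) = ~: (tau @: A).
  apply/setP => y; rewrite -(permKV tau y) inE !(mem_imset _ _ perm_inj) inE //.
by rewrite !imC eq_im.
Qed.

(** Inversions and non-inversions have a constant sum, so minimal [inv] means maximal [noninv]. *)
Lemma W_excessE (Delta : nat) : 0 < r ->
  W_excess n la Delta = [set pi in W n la | noninv pi + Delta == s * r].
Proof.
move=> r_gt0.
have [sigma0 W_sigma0 eq_sigma0] : exists2 sigma, sigma \in W n la & noninv sigma = s * r.
  (* The count for excess 0 is positive, so the bound [s * r] is attained. *)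
  have : 0 < p 2 0.
    rewrite card_gt0; apply/set0Pn; exists [ffun=> ord0].
    by rewrite inE big1 // => ? _; rewrite ffunE muln0.
  rewrite -(@card_W_lower_set r 0) ?eqxx // card_gt0 => /set0Pn [sigma].
  by rewrite inE addn0 => /and3P [? /eqP ? _]; exists sigma.
have inv_sum tau := inv_noninv (tau : 'S_n).
apply/setP => pi; apply/setIdP/setIdP => -[W_pi].
  case/existsP=> sigma /and3P [W_sigma /forall_inP min_sigma /eqP eq_pi]; split=> //.
  have := min_sigma _ W_sigma0; have := noninv_W W_sigma.
  have := inv_sum pi; have := inv_sum sigma; have := inv_sum sigma0; lia.
move=> /eqP eq_pi; split=> //; apply/existsP; exists sigma0; rewrite W_sigma0 /=.
apply/andP; split.
  apply/forall_inP => tau /noninv_W; have := inv_sum tau; have := inv_sum sigma0; lia.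
by apply/eqP; have := inv_sum pi; have := inv_sum sigma0; lia.
Qed.

End TwoColumns.

Theorem theorem2 (n : nat) (hn : 1 <= n) (la : seq nat)
    (hla : is_partition_of n la) (s r : nat)
    (hconj : conj_part la = [:: s; r]) (hr : 1 <= r) (hrs : r <= s)
    (Delta : nat) (hDelta : Delta < r) :
  w n la Delta = p 2 Delta * (if s == r then 1 else 2).
Proof.
have cardE := card_W_lower_set hla hconj hrs _ hDelta.
rewrite /w (W_excessE hla hconj hrs) //; set X := [set pi in _ | _].
(* The lower set has size [s] or [r], and each size accounts for [p 2 Delta] permutations; for
   [s = r] the two classes coincide. *)
rewrite -(cardsID [set pi | #|lower_set pi| == s] X).
have -> : #|X :&: [set pi | #|lower_set pi| == s]| = p 2 Delta.
  rewrite -(cardE s) ?eqxx ?orbT //; apply: eq_card => pi; rewrite !inE -!andbA //.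
have cardX pi : pi \in X -> (#|lower_set pi| == r) || (#|lower_set pi| == s).
  rewrite inE => /andP [W_pi /eqP eq_pi].
  by case: (card_lower_set_W hla hconj hrs W_pi eq_pi hDelta).
case: eqP => [eq_sr|ne_sr].
  rewrite muln1 (_ : _ :\: _ = set0) ?cards0 ?addn0 //; apply/setP => pi.
  rewrite in_setD in_set0; apply/negP => /andP [+ /cardX].
  by rewrite !inE eq_sr orbb => /negP.
rewrite muln2 -addnn; congr (_ + _); rewrite -(cardE r) ?eqxx //; apply: eq_card => pi.
rewrite in_setD; apply/andP/idP.
  move=> [+ X_pi]; have := cardX _ X_pi; move: X_pi; rewrite !inE => /andP [-> ->] /=.
  by case/orP => [-> //|->].
rewrite !inE => /and3P [-> -> /eqP ->]; split=> //.
by apply/eqP => eq_rs; apply: ne_sr.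
Qed.
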